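(* Let $f\colon\mathbb{R}^n\to\mathbb{R}^n$ be a ($C^1$) diffeomorphism and let $\mathcal{V}$ be a finite family of compact subsets of $\mathbb{R}^n$ with pairwise disjoint interiors. Let $\mathcal{G}=(\mathcal{V},\mathcal{E})$ be a directed graph which encodes a combinatorial representation of $f$ on $\mathrm{supp}(\mathcal{V})$, let $\{C_V\}_{V\in\mathcal{V}}$ be invertible $n\times n$ matrices, and let $Q(x,y)=\|x\|^2-\|y\|^2$, $x\in\mathbb{R}^u$, $y\in\mathbb{R}^s$, $u+s=n$. If the cone-condition verification algorithm (described in the context), called with arguments $\mathcal{G}$, $Q$ and $f$, returns the empty set, then $f$ is uniformly hyperbolic on $\mathrm{Inv}(f,\mathrm{supp}(\mathcal{V}))$.
   Context: Notation: $\mathrm{supp}(\mathcal{V})=\bigcup_{V\in\mathcal{V}}V$; $\mathrm{out}(V,\mathcal{G})=\{W\in\mathcal{V} : (V,W)\in\mathcal{E}\}$; $\mathcal{G}$ encodes a combinatorial representation of $f$ on $\mathrm{supp}(\mathcal{V})$ if for every $x\in\mathrm{supp}(\mathcal{V})$ and every $V\in\mathcal{V}$ with $x\in V$ one has $f(x)\in\mathrm{supp}(\mathrm{out}(V,\mathcal{G}))$. $Q$ also denotes the matrix $\mathrm{diag}(I_u,-I_s)$. $\mathrm{Inv}(f,M)=\{x\in M : f^k(x)\in M,\ f^{-k}(x)\in M\text{ for all }k\ge0\}$. Cone-condition verification algorithm. Start with $\mathcal{U}\leftarrow\emptyset$. For each $V\in\mathcal{V}$ compute an interval matrix $D$ (a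 matrix with interval entries, viewed as a set of real matrices) containing $Df(z)$ for all $z\in V$. For each $W\in\mathrm{out}(V,\mathcal{G})$ compute in interval arithmetic an interval matrix $M$ enclosing $C_WDC_V^{-1}$ (containing $C_WBC_V^{-1}$ for every real $B\in D$) and an interval matrix $A$ enclosing $M^TQM-Q$ (containing $B^TQB-Q$ for every real $B\in M$). If the program cannot verify that $A$ is positive definite (i.e. that every symmetric real matrix in $A$ is positive definite; the verification is rigorous, so a successful verification implies this property), set $\mathcal{U}\leftarrow\mathcal{U}\cup\{V\}$. Return $\mathcal{U}$. Uniform hyperbolicity: $f$ is uniformly hyperbolic on a compact invariant set $K\subset\mathbb{R}^n$ if $TK$, the restriction of $T\mathbb{R}^n$ to $K$, splits into a direct sum $TK=E^u\oplus E^s$ of two $Tf$-invariant sub-bundles and there are constants $c>0$, $0<\lambda<1$ such that $\|Df^k|_{E^s}v\|\le c\lambda^k\|v\|$ and $\|Df^{-k}|_{E^u}v\|\le c\lambda^k\|v\|$ for all $k\ge0$. *)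

(* Defs.v *)
From HB Require Import structures.
From mathcomp Require Import all_boot all_order all_algebra finmap.
From mathcomp Require Import all_classical all_reals all_analysis.
Import Order.TTheory GRing.Theory Num.Theory.
Import numFieldNormedType.Exports.

Set Implicit Arguments.
Unset Strict Implicit.
Unset Printing Implicit Defensive.

Local Open Scope classical_set_scope.
Local Open Scope ring_scope.

(* Points and vectors of R^n are columns, so that matrices act on the left. *)

(* The library norm on 'cV[R]_n is the sup norm; it induces the usual topology
   and differentials, but cones and hyperbolicity use the Euclidean norm. *)
Definition enorm (R : realType) (n : nat) (v : 'cV[R]_n) : R :=
  Num.sqrt (\sum_i v i 0 ^+ 2).

Definition Dmx (R : realType) (n : nat) (f : 'cV[R]_n -> 'cV[R]_n)
    (x : 'cV[R]_n) : 'M[R]_n :=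
  \matrix_(i, j) ('d f x (delta_mx j 0)) i 0.

Definition C1 (R : realType) (n : nat) (f : 'cV[R]_n -> 'cV[R]_n) : Prop :=
  (forall x, differentiable f x) /\ continuous (Dmx f).

Definition C1_diffeo (R : realType) (n : nat)
    (f finv : 'cV[R]_n -> 'cV[R]_n) : Prop :=
  [/\ cancel f finv, cancel finv f, C1 f & C1 finv].

Definition invariant_part (T : Type) (f finv : T -> T) (M : set T) : set T :=
  [set x | M x /\ forall k, M (iter k f x) /\ M (iter k finv x)].

(* A continuous vector sub-bundle of TK: near every point of K, the fibers have
   a basis depending continuously on the base point (a local frame). *)
Definition subbundle (R : realType) (n : nat) (K : set 'cV[R]_n)
    (E : 'cV[R]_n -> {vspace 'cV[R]_n}) : Prop :=
  forall x, K x ->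
  exists (U : set 'cV[R]_n) (d : nat) (e : 'I_d -> 'cV[R]_n -> 'cV[R]_n),
    [/\ open U, U x,
        forall i, {within K `&` U, continuous (e i)} &
        forall y, (K `&` U) y -> basis_of (E y) [seq e i y | i <- enum 'I_d]].

Definition D_invariant (R : realType) (n : nat) (f : 'cV[R]_n -> 'cV[R]_n)
    (K : set 'cV[R]_n) (E : 'cV[R]_n -> {vspace 'cV[R]_n}) : Prop :=
  forall x, K x -> (linfun ('d f x) @: E x)%VS = E (f x).

Definition uniformly_hyperbolic (R : realType) (n : nat)
    (f finv : 'cV[R]_n -> 'cV[R]_n) (K : set 'cV[R]_n) : Prop :=
  [/\ compact K, f @` K = K &
   exists Eu Es : 'cV[R]_n -> {vspace 'cV[R]_n},
   [/\ subbundle K Eu /\ subbundle K Es,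
       forall x, K x -> (Eu x + Es x)%VS = fullv /\ (Eu x :&: Es x)%VS = 0%VS,
       D_invariant f K Eu /\ D_invariant f K Es &
       exists c lambda : R,
       [/\ 0 < c, 0 < lambda < 1,
           forall x k v, K x -> v \in Es x ->
             enorm ('d (iter k f) x v) <= c * lambda ^+ k * enorm v &
           forall x k v, K x -> v \in Eu x ->
             enorm ('d (iter k finv) x v) <= c * lambda ^+ k * enorm v]]].

Record digraph (T : choiceType) := Digraph {
  vertices : {fset T};
  edges : {fset T * T};
  edgesP : forall v w, (v, w) \in edges -> v \in vertices /\ w \in vertices
}.

Definition out (T : choiceType) (v : T) (G : digraph T) : {fset T} :=
  [fset w in vertices G | (v, w) \in edges G]%fset.

Definition supp (T : Type) (A : {fset set T}) : set T :=
  \bigcup_(V in [set` A]) V.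

Definition encodes_representation (T : Type) (G : digraph (set T))
    (f : T -> T) : Prop :=
  forall x, supp (vertices G) x ->
  forall V, V \in vertices G -> V x -> supp (out V G) (f x).

Definition Qmx (R : realType) (u s : nat) : 'M[R]_(u + s) :=
  block_mx 1%:M 0 0 (- 1%:M).

Lemma QmxE (R : realType) (u s : nat) (x : 'cV[R]_u) (y : 'cV[R]_s) :
  ((col_mx x y)^T *m Qmx R u s *m col_mx x y) 0 0
    = enorm x ^+ 2 - enorm y ^+ 2.
Proof.
have E m (z : 'cV[R]_m) : (z^T *m z) 0 0 = enorm z ^+ 2.
  rewrite sqr_sqrtr; last by apply: sumr_ge0 => i _; exact: sqr_ge0.
  by rewrite !mxE; apply: eq_bigr => i _; rewrite !mxE expr2.
rewrite tr_col_mx mul_row_block mul_row_col !mulmx0 addr0 add0r mulmx1.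
by rewrite mulmxN mulmx1 mulNmx [LHS]mxE [X in _ + X]mxE !E.
Qed.

Definition posdef (R : realType) (n : nat) (A : 'M[R]_n) : Prop :=
  forall v : 'cV[R]_n, v != 0 -> 0 < (v^T *m A *m v) 0 0.

Definition imatrix (R : realType) (n : nat) := 'M[interval R]_n.

Definition in_imatrix (R : realType) (n : nat) (B : 'M[R]_n)
    (A : imatrix R n) : Prop :=
  forall i j, B i j \in A i j.

(* The interval-arithmetic routines called by the algorithm, with their
   guarantees.  [verify_posdef] may fail on an interval matrix whose symmetric
   elements are all positive definite; only its success is informative. *)
Record rigorous_arithmetic (R : realType) (n : nat) := RigorousArithmetic {
  enclose_D : ('cV[R]_n -> 'cV[R]_n) -> set 'cV[R]_n -> imatrix R n;
  enclose_conj : 'M[R]_n -> imatrix R n -> 'M[R]_n -> imatrix R n;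
  enclose_form : 'M[R]_n -> imatrix R n -> imatrix R n;
  verify_posdef : imatrix R n -> bool;
  enclose_DP : forall f V z, C1 f -> compact V -> V z ->
    in_imatrix (Dmx f z) (enclose_D f V);
  enclose_conjP : forall CW D CV B, CV \in unitmx -> in_imatrix B D ->
    in_imatrix (CW *m B *m invmx CV) (enclose_conj CW D CV);
  enclose_formP : forall Q M B, in_imatrix B M ->
    in_imatrix (B^T *m Q *m B - Q) (enclose_form Q M);
  verify_posdefP : forall A, verify_posdef A ->
    forall B, in_imatrix B A -> B^T = B -> posdef B
}.

Definition cone_verification (R : realType) (n : nat)
    (ar : rigorous_arithmetic R n) (G : digraph (set 'cV[R]_n))
    (C : set 'cV[R]_n -> 'M[R]_n) (Q : 'M[R]_n) (f : 'cV[R]_n -> 'cV[R]_n) :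
    {fset set 'cV[R]_n} :=
  foldl (fun U V =>
    let D := enclose_D ar f V in
    foldl (fun U W =>
      let M := enclose_conj ar (C W) D (C V) in
      let A := enclose_form ar Q M in
      if verify_posdef ar A then U else (U `|` [fset V])%fset)
    U (enum_fset (out V G)))
  fset0 (enum_fset (vertices G)).

(* Main.v *)
Require Import Defs.
From mathcomp Require Import all_boot all_order all_algebra finmap.
From mathcomp Require Import all_classical all_reals all_analysis.
From mathcomp Require Import ring lra zify.
Import Order.TTheory GRing.Theory Num.Theory.
Import numFieldNormedType.Exports.
Set Implicit Arguments.
Unset Strict Implicit.
Unset Printing Implicit Defensive.
Local Open Scope classical_set_scope.
Local Open Scope ring_scope.

(* Along any orbit in K the graph provides charts in which Q strictly increases:
   Q_W(Df v) >= Q_V(v) + eps |v|^2, with a uniform eps by compactness.  Let Es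
   and Eu consist of the vectors with bounded forward and backward orbits.
   Telescoping bounds every partial sum of |Df^k v|^2 along a bounded orbit by
   a multiple of its first and last terms, which forces geometric decay.  The
   preimages of {Q <= 0} under Df^N contain s-dimensional subspaces on which
   the orbits stay bounded up to time N; letting N go to infinity and using
   compactness of the unit sphere, dim Es >= s, and dim Eu >= u by the same
   argument for the inverse map and the form -Q.  On Es the form is at most
   -eps' |v|^2 and on Eu at least eps' |v|^2, so the two subspaces are
   uniformly transverse, hence complementary.  Continuity of the splitting
   follows from the decay rates and the continuity of Df^N for one large N. *)

(** * Matrix norms, limits and differentials *)

Section MatrixNorm.
Context {R : realType}.

Lemma ler_sum_ord n (F : 'I_n -> R) c :
  (forall i, F i <= c) -> \sum_i F i <= n%:R * c.
Proof.
move=> Fc; apply: (@le_trans _ _ (\sum_(i < n) c)); first exact: ler_sum.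
by rewrite sumr_const card_ord mulr_natl.
Qed.

Lemma mx_entry_le_norm m n (A : 'M[R]_(m, n)) i j : `|A i j| <= `|A|.
Proof.
rewrite [leRHS]/Num.Def.normr /= mx_normrE.
exact: (le_bigmax _ (fun ij : 'I_m * 'I_n => `|A ij.1 ij.2|) (i, j)).
Qed.

Lemma mx_norm_le m n (A : 'M[R]_(m, n)) c :
  0 <= c -> (forall i j, `|A i j| <= c) -> `|A| <= c.
Proof.
by move=> c0 Ac; rewrite [leLHS]/Num.Def.normr /= mx_normrE bigmax_le.
Qed.

Lemma norm_mulmx m n p (A : 'M[R]_(m, n)) (B : 'M[R]_(n, p)) :
  `|A *m B| <= n%:R * `|A| * `|B|.
Proof.
apply: mx_norm_le => [|i j]; first by rewrite !mulr_ge0.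
rewrite mxE (le_trans (ler_norm_sum _ _ _))//.
rewrite -mulrA; apply: ler_sum_ord => k.
by rewrite normrM ler_pM// mx_entry_le_norm.
Qed.

Lemma norm_trmx m n (A : 'M[R]_(m, n)) : `|A^T| = `|A|.
Proof.
apply/eqP; rewrite eq_le; apply/andP; split; apply: mx_norm_le => // i j.
  by rewrite mxE mx_entry_le_norm.
by rewrite -[A]trmxK mxE trmxK mx_entry_le_norm.
Qed.

Lemma norm_form_le n (S : 'M[R]_n) (v w : 'cV[R]_n) :
  `|(v^T *m S *m w) 0 0| <= n%:R ^+ 2 * `|S| * (`|v| * `|w|).
Proof.
apply: le_trans (mx_entry_le_norm _ _ _) _.
apply: le_trans (norm_mulmx _ _) _.
have -> : n%:R ^+ 2 * `|S| * (`|v| * `|w|)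
        = n%:R * (n%:R * `|v| * `|S|) * `|w| :> R by ring.
by rewrite ler_wpM2r// ler_wpM2l// -[X in _ * X * _]norm_trmx norm_mulmx.
Qed.

Lemma norm_le_enorm n (v : 'cV[R]_n) : `|v| <= enorm v.
Proof.
apply: mx_norm_le => [|i j]; first exact: sqrtr_ge0.
rewrite ord1 -sqrtr_sqr ler_sqrt; last by apply: sumr_ge0 => k _; exact: sqr_ge0.
by rewrite (bigD1 i)//= lerDl; apply: sumr_ge0 => k _; exact: sqr_ge0.
Qed.

Lemma enorm_le_norm n (v : 'cV[R]_n) : enorm v <= n%:R * `|v|.
Proof.
rewrite -[leRHS]ger0_norm ?mulr_ge0// -sqrtr_sqr ler_sqrt ?sqr_ge0//.
apply: (@le_trans _ _ (n%:R * `|v| ^+ 2)).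
  apply: ler_sum_ord => k; rewrite -real_normK ?num_real//.
  by rewrite ler_pXn2r// ?nnegrE// mx_entry_le_norm.
rewrite exprMn ler_wpM2r ?sqr_ge0// -natrX ler_nat.
by case: n v => // n _; rewrite expnS leq_pmulr// expn_gt0.
Qed.

End MatrixNorm.

Section MatrixLimits.
Context {R : realType} {T : Type} {F : set_system T} {FF : Filter F}.

Lemma cvg_mx m n (f : T -> 'M[R]_(m, n)) (A : 'M[R]_(m, n)) :
  (forall i j, f x i j @[x --> F] --> A i j) -> f @ F --> A.
Proof.
move=> fA; apply/cvgrPdist_le => e e0.
have : \forall x \near F, forall ij : 'I_m * 'I_n,
    `|A ij.1 ij.2 - f x ij.1 ij.2| <= e.
  by apply: filter_forall => -[i j]; have /cvgrPdist_le := fA i j; exact.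
apply: filterS => x xe; apply: mx_norm_le; first exact: ltW.
by move=> i j; rewrite !mxE; exact: xe (i, j).
Qed.

Lemma cvg_mx_entry m n (f : T -> 'M[R]_(m, n)) (A : 'M[R]_(m, n)) i j :
  f @ F --> A -> f x i j @[x --> F] --> A i j.
Proof. by move=> fA; exact: (cvg_comp _ _ fA (@coord_continuous _ _ _ _ _ _)). Qed.

Lemma cvg_mulmx m n p (f : T -> 'M[R]_(m, n)) (g : T -> 'M[R]_(n, p))
    (A : 'M[R]_(m, n)) (B : 'M[R]_(n, p)) :
  f @ F --> A -> g @ F --> B -> f x *m g x @[x --> F] --> A *m B.
Proof.
move=> fA gB; apply: cvg_mx => i j.
rewrite mxE; under eq_fun do rewrite mxE.
apply: cvg_big => [|k _]; first exact: add_continuous.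
by apply: cvgM; exact: cvg_mx_entry.
Qed.

Lemma cvg_trmx m n (f : T -> 'M[R]_(m, n)) (A : 'M[R]_(m, n)) :
  f @ F --> A -> (f x)^T @[x --> F] --> A^T.
Proof.
move=> fA; apply: cvg_mx => i j.
by rewrite mxE; under eq_fun do rewrite mxE; exact: cvg_mx_entry.
Qed.

End MatrixLimits.

(** The criterion for closed bounded sets is applied to row vectors and carried to columns by
    transposition. *)
Lemma compact_unit_sphere (R : realType) n :
  compact [set v : 'cV[R]_n | `|v| = 1].
Proof.
have -> : [set v : 'cV[R]_n | `|v| = 1] = trmx @` [set v : 'rV[R]_n | `|v| = 1].
  apply/seteqP; split => v /=; last by case=> w w1 <-; rewrite norm_trmx.
  by move=> v1; exists v^T; rewrite ?norm_trmx// trmxK.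
apply: continuous_compact.
  apply: continuous_subspaceT => v; exact: (@cvg_trmx _ _ (nbhs v) _ _ _ id).
apply: bounded_closed_compact.
  by exists 1; split => // x x1 v /= ->; rewrite ltW.
apply: (@preimage_closed _ _ (fun v : 'rV[R]_n => `|v|) [set 1]).
  by move=> v _; exact: norm_continuous.
exact: closed_eq.
Qed.

Section Differential.
Context {R : realType} {n : nat}.
Implicit Types (f g : 'cV[R]_n -> 'cV[R]_n).

Lemma linear_mulmxE m (g : {linear 'cV[R]_n -> 'cV[R]_m}) v :
  g v = (\matrix_(i, j) g (delta_mx j 0) i 0) *m v.
Proof.
have -> : v = \sum_j v j 0 *: delta_mx j 0.
  rewrite [LHS]matrix_sum_delta; apply: eq_bigr => j _.
  by rewrite big_ord1 ord1.
rewrite linear_sum mulmx_sumr; apply: eq_bigr => j _.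
rewrite linearZ -scalemxAr; congr (_ *: _).
by rewrite -colE; apply/colP => i; rewrite 2!mxE.
Qed.

Lemma diff_Dmx f x v : differentiable f x -> 'd f x v = Dmx f x *m v.
Proof. by move=> dfx; rewrite linear_mulmxE. Qed.

Lemma DmxE f x i j : Dmx f x i j = 'd f x (delta_mx j 0) i 0.
Proof. by rewrite mxE. Qed.

Local Opaque Dmx.

Lemma Dmx_comp f g x : differentiable f x -> differentiable g (f x) ->
  Dmx (g \o f) x = Dmx g (f x) *m Dmx f x.
Proof.
move=> dfx dgfx; apply/matrixP => i j.
transitivity ((Dmx g (f x) *m (Dmx f x *m delta_mx j (0 : 'I_1))) i 0).
  by rewrite DmxE diff_comp//= !diff_Dmx.
by rewrite mulmxA -colE mxE.
Qed.

Lemma Dmx_id x : Dmx (@id 'cV[R]_n) x = 1%:M.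
Proof.
apply/matrixP => i j; rewrite DmxE.
have -> : 'd (@id 'cV[R]_n) x = id :> (_ -> _).
  by apply: diff_val.
by rewrite !mxE eqxx andbT.
Qed.

End Differential.

(** The tails T_k of the series of b_k^2 satisfy T_k <= L b_k^2, because b_N tends to 0. Since b_k^2
    = T_k - T_{k+1}, the tails decay geometrically, and b_k^2 <= T_k. The constants depend on [L]
    alone, which later makes the decay uniform on [K]. *)
Lemma sum_bound_decay (R : realType) (L : R) : 0 < L ->
  exists c lam : R, [/\ 0 < c, 0 < lam < 1 &
    forall b : nat -> R, (forall k, 0 <= b k) ->
      (exists B, forall k, b k <= B) ->
      (forall i N, (i <= N)%N ->
         \sum_(i <= j < N) b j ^+ 2 <= L * (b i ^+ 2 + b N ^+ 2)) ->
      forall k, b k <= c * lam ^+ k * b 0].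
Proof.
(* Using [L + 1] in place of [L] keeps [r] strictly between 0 and 1 also when [L <= 1]. *)
move=> L0; pose r := 1 - (L + 1)^-1.
have L1 : 0 < L + 1 by rewrite addr_gt0.
have Li : (L + 1) * (L + 1)^-1 = 1 by rewrite mulfV// gt_eqF.
have r0 : 0 < r by rewrite subr_gt0 invf_lt1// ltrDr.
have r1 : r < 1 by rewrite ltrBlDr ltrDl invr_gt0.
exists (Num.sqrt (L + 1)), (Num.sqrt r); split.
- by rewrite sqrtr_gt0.
- by rewrite sqrtr_gt0 r0 -[ltRHS]sqrtr1 ltr_sqrt.
move=> b b0 [B bB] sb.
pose a k := b k ^+ 2.
have a0 k : 0 <= a k by exact: sqr_ge0.
have aB k : a k <= B ^+ 2.
  by rewrite ler_pXn2r ?nnegrE// (le_trans (b0 k)).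
(* Boundedness of [b] bounds the assumed right-hand sides uniformly in [N], hence the partial
   sums. *)
have ca : cvgn (series a).
  apply: nondecreasing_is_cvgn.
    by apply: nondecreasing_series => i _ _; exact: a0.
  exists (L * (B ^+ 2 + B ^+ 2)) => _ [n _ <-].
  apply: le_trans (sb 0%N n (leq0n n)) _.
  by rewrite ler_pM2l// (lerD (aB _) (aB _)).
have a_0 : a @ \oo --> (0 : R) by exact: cvg_series_cvg_0.
pose T k := limn (series a) - series a k.
have TS k : T k = T k.+1 + a k by rewrite /T seriesSr opprD addrA subrK.
(* Let [N] tend to infinity in the hypothesis; the end term [a N] vanishes. *)
have Ta k : T k <= L * a k.
  rewrite -[a k]addr0.
  apply: (@ler_cvg_to _ \oo _ _ (fun N => series a N - series a k)
            (fun N => L * (a k + a N))).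
  - by apply: cvgB => //; exact: cvg_cst.
  - by apply: cvgMl_tmp; apply: cvgD => //; exact: cvg_cst.
  - exists k => // N /= kN.
    by rewrite sub_series_geq// sb.
have T0 k : 0 <= T k.
  rewrite subr_ge0; apply: nondecreasing_cvgn_le => //.
  by apply: nondecreasing_series => i _ _; exact: a0.
have Tr k : T k.+1 <= r * T k.
  have : T k <= (L + 1) * a k by rewrite (le_trans (Ta k))// ler_wpM2r// lerDl.
  rewrite -ler_pdivrMl// => h; rewrite /r mulrBl mul1r.
  by rewrite [in leRHS](TS k) -addrA lerDl subr_ge0 -TS.
have Trk k : T k <= r ^+ k * T 0%N.
  elim: k => [|k IH]; first by rewrite expr0 mul1r.
  by rewrite (le_trans (Tr k))// exprS -mulrA ler_pM2l.
move=> k.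
rewrite -(@ler_pXn2r _ 2%N)// ?nnegrE//; last first.
  by rewrite !mulr_ge0// exprn_ge0// sqrtr_ge0.
have -> : (Num.sqrt (L + 1) * Num.sqrt r ^+ k * b 0) ^+ 2
    = r ^+ k * ((L + 1) * a 0%N).
  by rewrite !exprMn -exprM mulnC exprM !sqr_sqrtr ?ltW// mulrAC mulrC.
apply: (@le_trans _ _ (T k)); first by rewrite TS lerDr.
apply: le_trans (Trk k) _.
rewrite ler_wpM2l ?exprn_ge0 ?(ltW r0)//.
by rewrite (le_trans (Ta 0%N))// ler_wpM2r// lerDl.
Qed.

(** A subspace of maximal dimension inside [P] absorbs every [v] satisfying [P]: adding the line of
    [v] stays inside [P], so it cannot raise the dimension. *)
Lemma vspace_of_pred (K : fieldType) (vT : vectType K) (P : vT -> Prop) :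
  P 0 -> (forall a u v, P u -> P v -> P (a *: u + v)) ->
  exists U : {vspace vT}, forall v, v \in U <-> P v.
Proof.
move=> P0 PD.
pose D d := `[< exists2 U : {vspace vT}, \dim U = d & forall v, v \in U -> P v >].
have D0 : exists d, D d.
  exists 0%N; apply/asboolP; exists 0%VS; first exact: dimv0.
  by move=> v; rewrite memv0 => /eqP ->.
have Dle d : D d -> (d <= \dim {:vT})%N.
  by move=> /asboolP[U <- _]; exact/dimvS/subvf.
case: (ex_maxnP D0 Dle) => d /asboolP[U Ud UP] maxd.
exists U => v; split=> [|Pv]; first exact: UP.
have : D (\dim (U + <[v]>)).
  apply/asboolP; exists (U + <[v]>)%VS => // w /memv_addP[u uU [_ /vlineP[k ->] ->]].
  by rewrite addrC; apply: PD => //; exact: UP.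
move=> /maxd; rewrite -Ud => le.
have /eqP -> : U == (U + <[v]>)%VS by rewrite eqEdim addvSl.
by apply: (subvP (addvSr U <[v]>)); exact: memv_line.
Qed.

(** * Derivatives of iterates *)

Section Iterates.
Local Opaque Dmx.
Context {R : realType} {n : nat}.
Implicit Types (f g : 'cV[R]_n -> 'cV[R]_n).

Lemma C1_continuous f : C1 f -> continuous f.
Proof. by move=> [df _] x; exact/differentiable_continuous/df. Qed.

Lemma continuous_iter (T : topologicalType) (f : T -> T) k :
  continuous f -> continuous (iter k f).
Proof.
move=> cf; elim: k => [x|k IH x]; first exact: cvg_id.
by apply: (@continuous_comp _ _ _ (iter k f) f); [exact: IH|exact: cf].
Qed.

Lemma differentiable_iter f k x :
  (forall y, differentiable f y) -> differentiable (iter k f) x.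
Proof.
move=> df; elim: k => [|k IH]; first by rewrite (_ : iter 0 f = id).
exact: (@differentiable_comp _ _ _ _ (iter k f) f).
Qed.

Lemma Dmx_iterD f k m x : (forall y, differentiable f y) ->
  Dmx (iter (k + m) f) x = Dmx (iter k f) (iter m f x) *m Dmx (iter m f) x.
Proof.
move=> df; rewrite -Dmx_comp; [|exact: differentiable_iter..].
by congr (Dmx _ x); apply/funext => y; rewrite iterD.
Qed.

Lemma Dmx_iter0 f x : Dmx (iter 0 f) x = 1%:M.
Proof. exact: Dmx_id. Qed.

Lemma Dmx_iterS f k x : (forall y, differentiable f y) ->
  Dmx (iter k.+1 f) x = Dmx f (iter k f x) *m Dmx (iter k f) x.
Proof. by move=> df; rewrite -(Dmx_iterD 1). Qed.

Lemma continuous_Dmx_iter f k : C1 f -> continuous (Dmx (iter k f)).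
Proof.
move=> f1; have [df cDf] := f1; elim: k => [|k IH] x.
  rewrite (_ : Dmx _ = cst 1%:M); first exact: cst_continuous.
  by apply/funext => y; exact: Dmx_iter0.
rewrite (_ : Dmx _ = fun y => Dmx f (iter k f y) *m Dmx (iter k f) y); last first.
  by apply/funext => y; exact: Dmx_iterS.
have cDfk : continuous (Dmx f \o iter k f).
  move=> y; apply: continuous_comp; last exact: cDf.
  by apply: continuous_iter; exact: C1_continuous f1.
by apply: (@cvg_mulmx _ _ (nbhs x)); [exact: cDfk|exact: IH].
Qed.

Lemma Dmx_cancel f g x : cancel f g -> (forall y, differentiable f y) ->
  (forall y, differentiable g y) -> Dmx g (f x) *m Dmx f x = 1%:M.
Proof.
move=> fK df dg; rewrite -Dmx_comp// -[RHS](Dmx_id x).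
by congr (Dmx _ x); apply/funext => y; exact: fK.
Qed.

End Iterates.

(** * Cocycles with an increasing family of quadratic forms *)

Definition bform (R : realType) n (S : 'M[R]_n) (v w : 'cV[R]_n) : R :=
  (v^T *m S *m w) 0 0.

Lemma bformN (R : realType) n (S : 'M[R]_n) v w : bform (- S) v w = - bform S v w.
Proof. by rewrite /bform mulmxN mulNmx mxE. Qed.

Lemma bformDr (R : realType) n (S : 'M[R]_n) v w w' :
  bform S v (w + w') = bform S v w + bform S v w'.
Proof. by rewrite /bform mulmxDr mxE. Qed.

Lemma bformC (R : realType) n (S : 'M[R]_n) v w :
  S^T = S -> bform S v w = bform S w v.
Proof.
move=> sS; transitivity (((v^T *m S *m w)^T) 0 0); first by rewrite mxE.
by rewrite !trmx_mul trmxK sS mulmxA.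
Qed.

Lemma bformNl (R : realType) n (S : 'M[R]_n) v w : bform S (- v) w = - bform S v w.
Proof. by rewrite /bform linearN /= !mulNmx mxE. Qed.

(** Difference of squares for a symmetric form. It brings the two values close when [w + v] is
    small, which is the source of transversality. *)
Lemma bform_polar (R : realType) n (S : 'M[R]_n) v w : S^T = S ->
  bform S w w - bform S v v = bform S (w - v) (w + v).
Proof.
move=> sS; rewrite bformDr ![bform S (w - v) _]bformC// !bformDr.
by rewrite ![bform S _ (- v)]bformC// !bformNl; ring.
Qed.

Lemma exists_geo_le (R : realType) (C lam e : R) : 0 < lam < 1 -> 0 < e ->
  exists N, C * lam ^+ N <= e.
Proof.
move=> /andP[l0 l1] e0.
have : C * lam ^+ N @[N --> \oo] --> C * 0.
  by apply: cvgMl_tmp; apply: cvg_expr; rewrite ger0_norm// ltW.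
rewrite mulr0 => /cvgrPdist_le /(_ e e0)[N _ /(_ N (leqnn N))] /=.
by rewrite sub0r normrN => h; exists N; exact: le_trans (ler_norm _) h.
Qed.

(** Abstracts the derivatives of iterates: [mx k x] stands for Df^k at x and [mxD] for the chain
    rule. The same lemmas then serve a map and its inverse. *)
Record cocycle (R : realType) (n : nat) (T : Type) := Cocycle {
  base : T -> T;
  mx :> nat -> T -> 'M[R]_n;
  mx0 : forall x, mx 0 x = 1%:M;
  mxD : forall k m x, mx (k + m) x = mx k (iter m base x) *m mx m x
}.

Section ConeSystem.
Context {R : realType} {n : nat} {T : Type}.
Implicit Types (f g : cocycle R n T) (K : set T) (v : 'cV[R]_n).

(** One-sided: [g] undoes one step of [f]. A two-sided inverse is expressed by assuming the relation
    in both orders. *)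
Definition inverse_cocycle g f :=
  cancel (base f) (base g) /\ forall x, g 1 (base f x) *m f 1 x = 1%:M.

Lemma mxS f k x : f k.+1 x = f 1 (iter k (base f) x) *m f k x.
Proof. exact: (mxD f 1). Qed.

Lemma mxSr f k x : f k.+1 x = f k (base f x) *m f 1 x.
Proof. by rewrite -[k.+1]addn1 mxD. Qed.

Lemma iterK (f g : T -> T) k : cancel f g -> cancel (iter k f) (iter k g).
Proof. by move=> fK; elim: k => // k IH x; rewrite iterSr iterS fK IH. Qed.

Lemma cocycleK_iter f g k x : inverse_cocycle g f ->
  g k (iter k (base f) x) *m f k x = 1%:M.
Proof.
move=> [fK gf]; elim: k => [|k IH]; first by rewrite !mx0 mulmx1.
by rewrite mxSr mxS iterS fK mulmxA -(mulmxA _ (g 1 _)) gf mulmx1.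
Qed.

(* In the application S_j = C_{V_j}^T Q C_{V_j} along a path V_0, ..., V_N of the
   graph followed by the orbit of x. *)
Definition cone_system f K s u := exists eps C : R, [/\ 0 < eps, 0 < C &
  forall x N, K x -> exists S : nat -> 'M[R]_n,
  [/\ forall j, [/\ (S j)^T = S j,
          forall v w, `|bform (S j) v w| <= C * (`|v| * `|w|),
          exists2 F : {vspace 'cV[R]_n}, (s <= \dim F)%N &
            forall v, v \in F -> bform (S j) v v <= 0 &
          exists2 F : {vspace 'cV[R]_n}, (u <= \dim F)%N &
            forall v, v \in F -> 0 <= bform (S j) v v] &
      forall j v, (j < N)%N ->
        bform (S j) v v + eps * `|v| ^+ 2 <=
        bform (S j.+1) (f 1 (iter j (base f) x) *m v)
                      (f 1 (iter j (base f) x) *m v)]].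

Definition bounded_orbit f x v := exists B, forall k, `|f k x *m v| <= B.

Lemma stable_exists f x :
  exists U : {vspace 'cV[R]_n}, forall v, v \in U <-> bounded_orbit f x v.
Proof.
apply: vspace_of_pred; first by exists 0 => k; rewrite mulmx0 normr0.
move=> a u v [B uB] [B' vB]; exists (`|a| * B + B') => k.
rewrite mulmxDr -scalemxAr (le_trans (ler_normD _ _))// lerD// normrZ.
by rewrite ler_wpM2l.
Qed.

(** Defined by boundedness, a linear condition; decay is proved afterwards. The unstable space is
    [stable] of the inverse cocycle. *)
Definition stable f x := sval (cid (stable_exists f x)).

Lemma stableP f x v : v \in stable f x <-> bounded_orbit f x v.
Proof. exact: (svalP (cid (stable_exists f x))). Qed.

Section Growth.
Context (f : cocycle R n T) (x : T) (S : nat -> 'M[R]_n) (eps : R) (N : nat).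
Context (HS : forall j v, (j < N)%N ->
        bform (S j) v v + eps * `|v| ^+ 2 <=
        bform (S j.+1) (f 1 (iter j (base f) x) *m v)
                      (f 1 (iter j (base f) x) *m v)).

(** Telescoping of the one-step cone inequality along the orbit of [v]. *)
Lemma bform_growth v i k : (i <= k)%N -> (k <= N)%N ->
  \sum_(i <= j < k) eps * `|f j x *m v| ^+ 2 <=
  bform (S k) (f k x *m v) (f k x *m v) - bform (S i) (f i x *m v) (f i x *m v).
Proof.
elim: k => [|k IH]; first by rewrite leqn0 => /eqP -> _; rewrite big_geq// subrr.
rewrite leq_eqVlt => /orP[/eqP <- _|ik kN]; first by rewrite big_geq// subrr.
rewrite big_nat_recr// [X in X <= _]/=.
have := HS (f k x *m v) kN; rewrite mulmxA -mxS => h.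
apply: le_trans (lerD (IH ik (ltnW kN)) (lexx _)) _.
by rewrite addrAC lerD2r.
Qed.

End Growth.

Definition contracting f K := exists c lam : R, [/\ 0 < c, 0 < lam < 1 &
  forall x v k, K x -> v \in stable f x ->
    `|f k x *m v| <= c * lam ^+ k * `|v|].

(** Telescoping and the bound [C] on the forms give the hypothesis of [sum_bound_decay] with L = C /
    eps, whatever the path. *)
Lemma cone_system_contracting f K s u : cone_system f K s u -> contracting f K.
Proof.
move=> [eps [C [e0 C0 HS]]].
have [c [lam [c0 l01 dec]]] := sum_bound_decay (divr_gt0 C0 e0).
exists c, lam; split => // x v k Kx /stableP vB.
pose b j := `|f j x *m v|.
suff : b k <= c * lam ^+ k * b 0%N by rewrite /b mx0 mul1mx.
apply: dec => [j||i N iN]; [exact: normr_ge0|exact: vB|]; have [S [SP Sg]] := HS x N Kx.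
have := bform_growth Sg v iN (leqnn N).
have [_ /(_ (f i x *m v) (f i x *m v)) Si _ _] := SP i.
have [_ /(_ (f N x *m v) (f N x *m v)) SN _ _] := SP N.
rewrite -mulr_sumr -ler_pdivlMl// => /le_trans; apply.
rewrite mulrC [leRHS]mulrAC ler_pM2r ?invr_gt0// mulrDr.
by move: Si SN; rewrite -!expr2 !ler_norml /b => /andP[? ?] /andP[? ?]; lra.
Qed.

(** Reverse the path and change the sign of the forms: growth along [f] becomes growth along [g],
    and [s] and [u] change places. The bound [M] turns the gain eps |w|^2 at the image [w] of [v]
    under [g] into a gain in |v|^2. *)
Lemma cone_system_inv f g K s u M : inverse_cocycle g f -> inverse_cocycle f g ->
  (forall x, K x -> K (base g x)) ->
  0 < M -> (forall x v, K x -> `|f 1 x *m v| <= M * `|v|) ->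
  cone_system f K s u -> cone_system g K u s.
Proof.
move=> [fK gf] [gK fg] Kg M0 fM [eps [C [e0 C0 HS]]].
exists (eps / M ^+ 2), C; split => [||x N Kx] //; first by rewrite divr_gt0 ?exprn_gt0.
have Kgj j : K (iter j (base g) x) by elim: j => //= j; exact: Kg.
have [S [SP Sg]] := HS (iter N (base g) x) N (Kgj N).
(* The path for [f] starts at g^N x. For [j > N] the truncated difference repeats [S 0]; growth is
   required only for [j < N]. *)
exists (fun j => - S (N - j)%N); split => [j|j v jN].
  have [sS bS [F sF nF] [F' uF pF]] := SP (N - j)%N; split.
  - by rewrite linearN /= sS.
  - by move=> v w; rewrite bformN normrN.
  - by exists F' => // v vF; rewrite bformN oppr_le0 pF.
  - by exists F => // v vF; rewrite bformN oppr_ge0 nF.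
set w := g 1 (iter j (base g) x) *m v.
have iterNg : iter (N - j.+1) (base f) (iter N (base g) x) = base g (iter j (base g) x).
  by rewrite -{2}(subnK jN) iterD (iterK _ gK) iterS.
have lt : (N - j.+1 < N)%N by rewrite ltn_subrL/= (leq_ltn_trans _ jN).
have := Sg (N - j.+1)%N w lt.
rewrite iterNg -subSn// subSS mulmxA fg mul1mx !bformN => h.
have wM : `|v| <= M * `|w|.
  by rewrite -[in leLHS](mul1mx v) -(fg (iter j (base g) x)) -mulmxA fM//; exact: Kgj j.+1.
have : eps / M ^+ 2 * `|v| ^+ 2 <= eps * `|w| ^+ 2.
  rewrite -mulrA ler_pM2l// ler_pdivrMl ?exprn_gt0// -exprMn.
  by rewrite ler_pXn2r// ?nnegrE// mulr_ge0// ltW.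
by move: h; lra.
Qed.

End ConeSystem.

Lemma mulmx_continuous (R : realType) m n (M : 'M[R]_(m, n)) :
  continuous (fun v : 'cV[R]_n => M *m v).
Proof.
move=> v; apply: (@cvg_mulmx _ _ (nbhs v) _ _ _ _ (fun=> M) id) => //.
exact: cvg_cst.
Qed.

Lemma norm_mulmx_continuous (R : realType) m n (M : 'M[R]_(m, n)) :
  continuous (fun v : 'cV[R]_n => `|M *m v|).
Proof.
move=> v; apply: (@continuous_comp _ _ _ (fun v => M *m v) (fun w => `|w|)).
  exact: mulmx_continuous.
exact: norm_continuous.
Qed.

(** The subspace is the zero set of |(M - 1) v|, with [M] the matrix of a projection onto it. *)
Lemma closed_vspace (R : realType) n (U : {vspace 'cV[R]_n}) :
  closed [set v | v \in U].
Proof.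
pose M := \matrix_(i, j) projv U (delta_mx j 0) i 0 : 'M[R]_n.
have ME v : projv U v = M *m v by exact: linear_mulmxE.
have -> : [set v | v \in U] = (fun v => `|(M - 1%:M) *m v|) @^-1` [set 0].
  apply/seteqP; split => v /=; rewrite mulmxBl mul1mx -ME.
    by move=> vU; rewrite projv_id// subrr normr0.
  by move=> /normr0_eq0/eqP; rewrite subr_eq0 => /eqP <-; exact: memv_proj.
apply: (@preimage_closed _ _ (fun v => `|(M - 1%:M) *m v|) [set 0]); last first.
  exact: closed_eq.
by move=> v _; exact: norm_mulmx_continuous.
Qed.

(** * Dimension and invariance of the stable spaces *)

Section Hyperbolic.
Context {R : realType} {n : nat} {T : Type}.
Implicit Types (f g : cocycle R n T) (K : set T) (v : 'cV[R]_n).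

(** Were the dimension below [s], a complement [L] of the stable space would meet, for each [N], the
    pullback by f^N of a space of dimension at least [s] where the last form is <= 0. Unit vectors
    there have orbits bounded up to time [N], and a cluster point of them lies both in [L] and in
    the stable space. *)
Lemma cone_system_dim f g K s u x : inverse_cocycle g f ->
  cone_system f K s u -> K x -> (s <= \dim (stable f x))%N.
Proof.
move=> gf [eps [C [e0 C0 HS]]] Kx; rewrite leqNgt; apply/negP => lts.
pose L := (stable f x)^C%VS.
have dimL : (\dim L + \dim (stable f x) = \dim (fullv : {vspace 'cV[R]_n}))%N.
  by rewrite dimv_compl subnK// dimvS// subvf.
have fNinv N : f N x *m g N (iter N (base f) x) = 1%:M.
  exact/mulmx1C/cocycleK_iter.
have Lw N : exists w, [/\ w \in L, `|w| = 1 &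
    forall j, (j < N)%N -> `|f j x *m w| ^+ 2 <= C / eps].
  have [S [SP Sg]] := HS x N Kx.
  have [_ _ [F sF nF] _] := SP N.
  (* [h] inverts f^N, so [h @: F] is the preimage of [F], of the same dimension. *)
  pose h := linfun (mulmx (g N (iter N (base f) x))) : 'End('cV[R]_n).
  have hE v : h v = g N (iter N (base f) x) *m v by rewrite lfunE.
  have dimhF : \dim (h @: F) = \dim F.
    apply: limg_dim_eq; apply/eqP; rewrite -subv0; apply/subvP => v.
    rewrite memv_cap memv_ker hE memv0 => /andP[_ /eqP hv].
    by rewrite -[v]mul1mx -(fNinv N) -mulmxA hv mulmx0.
  have : (L :&: (h @: F) != 0)%VS.
    rewrite -dimv_eq0 -lt0n; have := dimv_sum_cap L (h @: F).
    have : (\dim (L + h @: F) <= \dim (fullv : {vspace 'cV[R]_n}))%N.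
      by apply: dimvS; exact: subvf.
    by move: sF lts dimL; rewrite dimhF; lia.
  rewrite -vpick0; set w := vpick _ => w0.
  have : w \in (L :&: (h @: F))%VS by exact: memv_pick.
  rewrite memv_cap => /andP[wL /memv_imgP[z zF wz]].
  have nw0 : `|w| != 0 by rewrite normr_eq0.
  exists (`|w|^-1 *: w); split => [||j jN]; first exact: memvZ.
    by rewrite normrZ normfV normr_id mulVf.
  set w1 := _ *: w.
  have w11 : `|w1| = 1 by rewrite normrZ normfV normr_id mulVf.
  (* The final value of the form is at most 0 and the initial one at least -C, so the squared norms
     sum to at most C / eps. *)
  have := bform_growth Sg w1 (leq0n N) (leqnn N).
  have -> : f N x *m w1 = `|w|^-1 *: z.
    by rewrite -scalemxAr wz hE mulmxA fNinv mul1mx.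
  have := nF (`|w|^-1 *: z) (memvZ _ zF).
  have [_ /(_ (f 0 x *m w1) (f 0 x *m w1)) S0 _ _] := SP 0%N.
  move: S0; rewrite mx0 mul1mx w11 !mulr1 ler_norml => /andP[S0 _] SN.
  rewrite -mulr_sumr ler_pdivlMr// mulrC => h1.
  have : eps * `|f j x *m w1| ^+ 2 <=
      eps * \sum_(0 <= i < N) `|f i x *m w1| ^+ 2.
    rewrite ler_pM2l// big_mkord (bigD1 (Ordinal jN))//= lerDl.
    by apply: sumr_ge0 => i _; exact: sqr_ge0.
  by move: h1 SN S0; lra.
have [w wP] := choice Lw.
have sph : (w @ \oo) [set v | `|v| = 1].
  by exists 0%N => // N _ /=; have [] := wP N.
have [p [p1 clp]] := @compact_unit_sphere R n (w @ \oo) _ sph.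
(* A closed set containing almost all [w N] contains their cluster point. *)
have memp A : closed A -> (\forall N \near \oo, A (w N)) -> A p.
  by move=> cA wA; apply: cA => B pB; exact: clp.
have pL : p \in L.
  apply: (memp [set v | v \in L]); first exact: closed_vspace.
  by exists 0%N => // N _ /=; have [] := wP N.
have pS : p \in stable f x.
  apply/stableP; exists (Num.sqrt (C / eps)) => k.
  apply: (memp [set v | `|f k x *m v| <= Num.sqrt (C / eps)]).
    apply: (@preimage_closed _ _ (fun v => `|f k x *m v|) [set r | r <= _]).
      by move=> v _; exact: norm_mulmx_continuous.
    exact: closed_le.
  exists k.+1 => // N /= kN; have [_ _ /(_ k kN) h] := wP N.
  by rewrite -[leLHS]ger0_norm// -sqrtr_sqr ler_wsqrtr.
have : p \in (L :&: stable f x)%VS by rewrite memv_cap pL.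
rewrite capvC capv_compl memv0 => /eqP p0.
by move: p1; rewrite /= p0 normr0 => /eqP; rewrite eq_sym oner_eq0.
Qed.

Lemma stable_fwd f x v :
  v \in stable f x -> f 1 x *m v \in stable f (base f x).
Proof.
move=> /stableP[B vB]; apply/stableP; exists B => k.
by rewrite mulmxA -mxSr.
Qed.

Lemma stable_bwd f x v :
  f 1 x *m v \in stable f (base f x) -> v \in stable f x.
Proof.
move=> /stableP[B vB]; apply/stableP; exists (`|v| + B) => -[|k].
  by rewrite mx0 mul1mx lerDl (le_trans _ (vB 0%N)).
by rewrite mxSr -mulmxA (le_trans (vB k))// lerDr.
Qed.

(** One step of [g] takes the image back to the vector, so its orbit under [g] only gains an initial
    term. *)
Lemma stable_inv_fwd f g k x v : inverse_cocycle g f ->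
  v \in stable g x -> f k x *m v \in stable g (iter k (base f) x).
Proof.
move=> [fK gf] vg; elim: k => [|k IH]; first by rewrite mx0 mul1mx.
rewrite mxS -mulmxA; apply: stable_bwd.
by rewrite mulmxA gf mul1mx /= fK.
Qed.

End Hyperbolic.

(** * Uniform transversality *)

Section Splitting.
Context {R : realType} {n : nat} {T : Type}.
Implicit Types (f g : cocycle R n T) (K : set T) (v : 'cV[R]_n).

(** Quantitative trivial intersection: the angle between the two spaces is bounded away from 0
    uniformly on [K]. *)
Definition transverse f g K := exists2 c : R, 0 < c &
  forall x a b, K x -> a \in stable f x -> b \in stable g x ->
    `|a| + `|b| <= c * `|a + b|.

Lemma transverseC f g K : transverse f g K -> transverse g f K.
Proof.
move=> [c c0 tr]; exists c => // x a b Kx aS bS.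
by rewrite addrC [a + b]addrC; exact: (tr x).
Qed.

(** Contraction makes the end values of the form on a long path negligible, so at its centre the
    form is at most -(e/2)|a|^2 at [a] and at least (e/2)|b|^2 at [b]. Hence (e/2)(|a|^2 + |b|^2) <=
    C |b - a| |b + a|; bound |b - a| by |a| + |b| and divide by this sum. *)
Lemma cone_system_transverse f g K s u M :
  inverse_cocycle g f -> inverse_cocycle f g ->
  (forall x, K x -> K (base g x)) ->
  0 < M -> (forall x v, K x -> `|f 1 x *m v| <= M * `|v|) ->
  cone_system f K s u -> contracting f K -> contracting g K ->
  transverse f g K.
Proof.
move=> gf fg Kg M0 fM [eps [C [e0 C0 HS]]].
move=> [cf [lf [cf0 lf01 df]]] [cg [lg [cg0 lg01 dg]]].
(* [eps] serves the step leaving the centre, [eps / M ^+ 2] the step arriving there, whose gain is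
   measured at the previous point. *)
have [e [ee0 e_eps e_M]] : exists e, [/\ 0 < e, e <= eps & e <= eps / M ^+ 2].
  exists (Num.min eps (eps / M ^+ 2)).
  by rewrite lt_min e0 divr_gt0 ?exprn_gt0// !ge_min !lexx orbT.
have e20 : 0 < e / 2 by rewrite divr_gt0.
have small (h : cocycle R n T) c l : 0 < c -> 0 < l < 1 ->
    (forall x v k, K x -> v \in stable h x -> `|h k x *m v| <= c * l ^+ k * `|v|) ->
    exists N0, forall N x v, (N0 <= N)%N -> K x -> v \in stable h x ->
      C * `|h N x *m v| ^+ 2 <= e / 2 * `|v| ^+ 2.
  move=> c0 l01 dh; have [N0 hN0] := exists_geo_le (C * c ^+ 2) l01 e20.
  have /andP[l0 l1] := l01.
  exists N0 => N x v NN Kx vS.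
  have lN : l ^+ N <= l ^+ N0 by rewrite ler_wiXn2l// ltW.
  have lN2 : (l ^+ N) ^+ 2 <= l ^+ N0.
    rewrite expr2 (le_trans _ lN)// ler_piMr//.
      by rewrite exprn_ge0// ltW.
    by rewrite exprn_ile1// ltW.
  apply: (@le_trans _ _ (C * (c * l ^+ N * `|v|) ^+ 2)).
    rewrite ler_pM2l// ler_pXn2r ?nnegrE ?dh//.
    by rewrite !mulr_ge0 ?exprn_ge0// ltW.
  rewrite !exprMn [C * _]mulrA [C * _]mulrA ler_wpM2r ?sqr_ge0//.
  rewrite (le_trans _ hN0)//.
  by rewrite ler_pM2l// mulr_gt0// exprn_gt0.
have [N1 small_f] := small _ _ _ cf0 lf01 df.
have [N2 small_g] := small _ _ _ cg0 lg01 dg.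
exists (4 * C / e) => [|x a b Kx aS bS]; first by rewrite divr_gt0// mulr_gt0.
(* A path of length 2N centred at x, with N = p + 1: its second half controls
   [a] and its first half controls [b]. *)
have [p [N1p N2p]] : exists p, (N1 <= p.+1)%N /\ (N2 <= p.+1)%N.
  by exists (N1 + N2)%N; split; [rewrite leqW ?leq_addr|rewrite leqW ?leq_addl].
have [y [Ky Ky1 yx back]] : exists y, [/\ K y, K (iter p (base f) y),
    iter p.+1 (base f) y = x & forall v, f p.+1 y *m (g p.+1 x *m v) = v].
  have Kgk k z : K z -> K (iter k (base g) z) by elim: k => //= k IH /IH; exact: Kg.
  exists (iter p.+1 (base g) x); split => [|||v]; first exact: Kgk.
  - by rewrite iterSr (iterK _ fg.1); exact: Kg.
  - exact: iterK fg.1 _.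
  - by rewrite mulmxA cocycleK_iter// mul1mx.
have [S [SP Sg]] := HS y (p.+1 + p.+1)%N Ky.
have [sS SN _ _] := SP p.+1.
have Ha : e / 2 * `|a| ^+ 2 <= - bform (S p.+1) a a.
  have := bform_growth Sg (g p.+1 x *m a) (leq_addr p.+1 p.+1) (leqnn _).
  rewrite back mxD -mulmxA back yx.
  have h2 := small_f p.+1 x a N1p Kx aS.
  have [_ /(_ (f p.+1 x *m a) (f p.+1 x *m a)) + _ _] := SP (p.+1 + p.+1)%N.
  rewrite ler_norml -expr2 => /andP[_ h1] h3.
  (* Only the first term of the sum, the one at the centre, is kept. *)
  have : eps * `|a| ^+ 2 <= \sum_(p.+1 <= j < p.+1 + p.+1) eps * `|f j y *m (g p.+1 x *m a)| ^+ 2.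
    rewrite big_ltn ?back ?lerDl; last by rewrite addSn ltnS leq_addl.
    by apply: sumr_ge0 => j _; rewrite mulr_ge0 ?sqr_ge0// ltW.
  have : e * `|a| ^+ 2 <= eps * `|a| ^+ 2 by rewrite ler_wpM2r ?sqr_ge0.
  by lra.
have Hb : e / 2 * `|b| ^+ 2 <= bform (S p.+1) b b.
  have := bform_growth Sg (g p.+1 x *m b) (leq0n p.+1) (leq_addr _ _).
  rewrite back mx0 mul1mx.
  have h2 := small_g p.+1 x b N2p Kx bS.
  have [_ /(_ (g p.+1 x *m b) (g p.+1 x *m b)) + _ _] := SP 0%N.
  rewrite ler_norml -expr2 => /andP[h1 _] h3.
  (* [w] is the vector one step before the centre; only its term is kept. *)
  set w := f p y *m (g p.+1 x *m b).
  have : eps * `|w| ^+ 2 <= \sum_(0 <= j < p.+1) eps * `|f j y *m (g p.+1 x *m b)| ^+ 2.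
    rewrite big_nat_recr//= lerDr.
    by apply: sumr_ge0 => j _; rewrite mulr_ge0 ?sqr_ge0// ltW.
  have bw : `|b| <= M * `|w|.
    by rewrite -[in leLHS](back b) mxS -mulmxA fM.
  have : `|b| ^+ 2 <= (M * `|w|) ^+ 2.
    by rewrite ler_pXn2r ?nnegrE// mulr_ge0// ltW.
  rewrite exprMn => h4.
  have : e * `|b| ^+ 2 <= eps * `|w| ^+ 2.
    apply: (@le_trans _ _ (eps / M ^+ 2 * `|b| ^+ 2)).
      by rewrite ler_wpM2r ?sqr_ge0.
    by rewrite -mulrA ler_pM2l// ler_pdivrMl ?exprn_gt0.
  by lra.
have : bform (S p.+1) b b - bform (S p.+1) a a <= C * (`|b - a| * `|b + a|).
  by rewrite bform_polar// (le_trans (ler_norm _)).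
have hba : `|b - a| * `|b + a| <= (`|a| + `|b|) * `|a + b|.
  by rewrite [b + a]addrC ler_wpM2r// [X in _ <= X]addrC ler_normB.
rewrite -(ler_pM2l C0) in hba.
move=> /le_trans/(_ hba) hab.
have := sqr_ge0 (`|a| - `|b|); rewrite sqrrB => hsq.
set q := `|a| + `|b| in hab *; set r := `|a + b| in hab *.
have q0 : 0 <= q by rewrite addr_ge0.
have hq : q * (e * q) <= q * (4 * C * r).
  have : q ^+ 2 = `|a| ^+ 2 + `|b| ^+ 2 + `|a| * `|b| *+ 2 by rewrite sqrrD; ring.
  rewrite mulrCA -expr2 => ->; rewrite -mulrA [q * _]mulrC.
  have : e * (`|a| ^+ 2 + `|b| ^+ 2 + `|a| * `|b| *+ 2) <=
      e * (2 * (`|a| ^+ 2 + `|b| ^+ 2)) by rewrite ler_wpM2l ?(ltW ee0)//; lra.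
  by lra.
have [->|qn0] := eqVneq q 0; first exact: mulr_ge0 (ltW (divr_gt0 (mulr_gt0 _ C0) ee0)) (normr_ge0 _).
have q1 : 0 < q by rewrite lt_def qn0.
by move: hq; rewrite ler_pM2l// [X in _ -> _ <= X]mulrAC ler_pdivlMr// mulrC.
Qed.

End Splitting.

(** * Continuity of the stable bundle *)

Section Perturbation.
Context {R : realType} {n : nat} {T : topologicalType}.
Implicit Types (f g : cocycle R n T) (K : set T) (v : 'cV[R]_n).

(** Split a vector stable at [x] into its stable part [a] and unstable part [b] at [y]. For [y]
    close to [x] the image of [b] under f^N at [y] is at most a constant times |a + b|, with a
    constant independent of [N]. Going back contracts it by l2^N, so [b] is small. *)
Lemma stable_near f g K x delta : inverse_cocycle g f ->
  (forall k, continuous (f k)) -> (forall y, K y -> K (base f y)) ->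
  contracting f K -> contracting g K -> transverse f g K ->
  K x -> 0 < delta ->
  \forall y \near x, K y -> forall a b, b \in stable g y ->
    a + b \in stable f x -> a \in stable f y -> `|b| <= delta * `|a + b|.
Proof.
move=> gf fC Kf [c1 [l1 [c10 /andP[l10 l11] df]]] [c2 [l2 [c20 l201 dg]]].
move=> [c3 c30 tr] Kx d0.
(* The summands bound, in order, the change of base point, the orbit of [a + b] at [x] and that of
   [a] at [y]. *)
have [N hN] := exists_geo_le (c2 * (1 + c1 + c1 * c3)) l201 d0.
have /andP[l20 l21] := l201.
have n0 : 0 < n%:R + 1 :> R by rewrite ltr_wpDl.
(* The sup norm of a product costs a factor [n]; this closeness makes the perturbation term at most
   |a + b|. *)
have nu0 : 0 < (n%:R + 1)^-1 :> R by rewrite invr_gt0.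
have /cvgrPdist_le/(_ _ nu0) := fC N x.
apply: filterS => y xy Ky a b bS abS aS.
have KfN k : K (iter k (base f) y) by elim: k => //= k; exact: Kf.
have l1N : l1 ^+ N <= 1 by rewrite exprn_ile1// ltW.
have ab : `|a| <= c3 * `|a + b|.
  by rewrite (le_trans _ (tr _ _ _ Ky aS bS))// lerDl.
have fa : `|f N y *m a| <= c1 * c3 * `|a + b|.
  rewrite (le_trans (df _ _ N Ky aS))// -mulrA.
  rewrite -[in leRHS]mulrA ler_pM2l// (le_trans _ ab)// ler_piMl//.
have fab0 : `|f N x *m (a + b)| <= c1 * `|a + b|.
  rewrite (le_trans (df _ _ N Kx abS))// -mulrA ler_pM2l// ler_piMl//.
have fabd : `|(f N x - f N y) *m (a + b)| <= `|a + b|.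
  rewrite (le_trans (norm_mulmx _ _))// ler_piMl//.
  apply: (@le_trans _ _ (n%:R * (n%:R + 1)^-1)); first by rewrite ler_wpM2l.
  by rewrite ler_pdivrMr// mul1r lerDl.
have fb : `|f N y *m b| <= (1 + c1 + c1 * c3) * `|a + b|.
  have -> : f N y *m b =
      f N x *m (a + b) - (f N x - f N y) *m (a + b) - f N y *m a.
    by rewrite mulmxBl opprB addrCA subrr addr0 mulmxDr addrC addKr.
  rewrite (le_trans (ler_normB _ _))// (le_trans (lerD (ler_normB _ _) (lexx _)))//.
  by lra.
have := dg _ _ N (KfN N) (stable_inv_fwd N gf bS).
rewrite mulmxA cocycleK_iter// mul1mx => /le_trans; apply.
apply: (@le_trans _ _ (c2 * l2 ^+ N * ((1 + c1 + c1 * c3) * `|a + b|))).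
  by rewrite ler_wpM2l// mulr_ge0 ?exprn_ge0// ltW.
by rewrite mulrA ler_wpM2r// mulrAC.
Qed.

End Perturbation.

(** * Local frames of the stable bundle *)

Section Subbundle.
Context {R : realType} {n : nat}.
Implicit Types (f g : cocycle R n 'cV[R]_n) (K : set 'cV[R]_n) (v : 'cV[R]_n).

(** The projections onto the stable spaces along the unstable ones vary continuously. Projecting a
    fixed basis of the space at [x] gives the frame: near [x] the projection is injective on that
    space, and the dimension is constant. *)
Lemma stable_subbundle f g K d :
  inverse_cocycle g f -> inverse_cocycle f g ->
  (forall k, continuous (f k)) -> (forall k, continuous (g k)) ->
  (forall y, K y -> K (base f y)) -> (forall y, K y -> K (base g y)) ->
  contracting f K -> contracting g K -> transverse f g K ->
  (forall y, K y -> (stable f y + stable g y)%VS = fullv) ->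
  (forall y, K y -> (stable f y :&: stable g y)%VS = 0%VS) ->
  (forall y, K y -> \dim (stable f y) = d) ->
  subbundle K (stable f).
Proof.
move=> gf fg fC gC Kf Kg cf cg tr full cap0 dimf.
pose pi y w := daddv_pi (stable f y) (stable g y) w.
pose pj y w := daddv_pi (stable g y) (stable f y) w.
have piS y w : pi y w \in stable f y by exact: memv_pi.
have pjS y w : pj y w \in stable g y by exact: memv_pi.
have pij y w : K y -> pi y w + pj y w = w.
  by move=> Ky; rewrite daddv_pi_add ?cap0// full// memvf.
have near_f x e : K x -> 0 < e -> \forall y \near x, K y ->
    forall a, a \in stable f x -> `|a - pi y a| <= e * `|a|.
  move=> Kx e0; have := stable_near gf fC Kf cf cg tr Kx e0.
  apply: filterS => y h Ky a aS; have := h Ky (pi y a) (pj y a).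
  have -> : a - pi y a = pj y a by apply/eqP; rewrite subr_eq addrC pij.
  by rewrite pij// => /(_ (pjS y a) aS (piS y a)).
(* The same estimate for the inverse cocycle, with the two spaces exchanged. *)
have near_g x e : K x -> 0 < e -> \forall y \near x, K y ->
    forall b, b \in stable g x -> `|pi y b| <= e * `|b|.
  move=> Kx e0; have := stable_near fg gC Kg cg cf (transverseC tr) Kx e0.
  apply: filterS => y h Ky b bS; have := h Ky (pj y b) (pi y b).
  by rewrite addrC pij// => /(_ (piS y b) bS (pjS y b)).
have pi_cont w x e : K x -> 0 < e -> \forall y \near x, K y -> `|pi x w - pi y w| <= e.
  move=> Kx e0; set r := `|pi x w| + `|pj x w| + 1.
  have r0 : 0 < r by rewrite ltr_wpDl// addr_ge0.
  have er0 : 0 < e / r by rewrite divr_gt0.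
  apply: filterS2 (near_f x _ Kx er0) (near_g x _ Kx er0) => y h1 h2 Ky.
  have -> : pi x w - pi y w = (pi x w - pi y (pi x w)) - pi y (pj x w).
    by rewrite -addrA -opprD -[pi y _ + _]linearD/= pij.
  rewrite (le_trans (ler_normB _ _))//.
  apply: (@le_trans _ _ (e / r * r)); last by rewrite divfK// gt_eqF.
  rewrite (le_trans (lerD (h1 Ky _ (piS x w)) (h2 Ky _ (pjS x w))))//.
  by rewrite -mulrDr ler_pM2l// lerDl.
move=> x Kx.
(* With relative error 1/2 no nonzero vector stable at [x] is projected to 0. *)
have := near_f x 2^-1 Kx; rewrite invr_gt0 => /(_ (ltr0n _ 2)).
rewrite /prop_near1 nbhsE => -[U [oU Ux] hU].
pose X := vbasis (stable f x).
exists U, (\dim (stable f x)), (fun i y => pi y X`_i); split => // [i|y [Ky Uy]].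
  apply/subspace_continuousP => y [Ky _]; apply/cvgrPdist_le => e e0.
  rewrite near_withinE; apply: filterS (pi_cont X`_i y e Ky e0) => z h [Kz _].
  exact: h.
have -> : [seq pi y X`_(nat_of_ord i) | i <- enum 'I_(\dim (stable f x))] = map (pi y) X.
  by rewrite -[in RHS](map_tnth_enum X) -map_comp; apply: eq_map => i /=; rewrite (tnth_nth 0).
have inj : (stable f x :&: lker (daddv_pi (stable f y) (stable g y)))%VS = 0%VS.
  apply/eqP; rewrite -subv0; apply/subvP => w.
  rewrite memv_cap memv_ker memv0 => /andP[wS /eqP w0].
  have := hU _ Uy Ky w wS; rewrite /pi w0 subr0 => h.
  by rewrite -normr_eq0; have := normr_ge0 w; lra.
have im : (daddv_pi (stable f y) (stable g y) @: stable f x)%VS = stable f y.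
  apply/eqP; rewrite eqEdim limg_dim_eq// !dimf// leqnn andbT.
  by apply/subvP => _ /memv_imgP[w _ ->]; exact: memv_pi.
have sX : size X = \dim (stable f y) by rewrite size_tuple !dimf.
rewrite basisEdim size_map sX leqnn andbT -[X in (X <= _)%VS]im.
have spanX : <<X>>%VS = stable f x by exact/span_basis/vbasisP.
by rewrite -[X in (_ @: X)%VS]spanX limg_span.
Qed.

End Subbundle.

(** * From the verification algorithm to the cone condition *)

Lemma dim_mulmx_image (R : realType) m n (M : 'M[R]_(m, n)) (L : 'M[R]_(n, m)) :
  L *m M = 1%:M ->
  \dim (linfun (mulmx M : 'cV_n -> 'cV_m) @: (fullv : {vspace 'cV[R]_n})) = n.
Proof.
move=> LM; rewrite limg_dim_eq; first by rewrite dimvf /dim /= muln1.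
apply/eqP; rewrite -subv0; apply/subvP => v.
rewrite memv_cap memv_ker lfunE memv0 /= => /andP[_ /eqP Mv].
by rewrite -[v]mul1mx -LM -mulmxA Mv mulmx0.
Qed.

Lemma bform_conj (R : realType) n (C Q : 'M[R]_n) v w :
  bform (C^T *m Q *m C) v w = bform Q (C *m v) (C *m w).
Proof. by rewrite /bform trmx_mul !mulmxA. Qed.

Lemma bformB (R : realType) n (S S' : 'M[R]_n) v w :
  bform (S - S') v w = bform S v w - bform S' v w.
Proof. by rewrite /bform mulmxBr mulmxBl !mxE. Qed.

Lemma bformZ (R : realType) n (S : 'M[R]_n) a v :
  bform S (a *: v) (a *: v) = a ^+ 2 * bform S v v.
Proof.
have trZ : (a *: v)^T = a *: v^T by apply/matrixP => i j; rewrite !mxE.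
by rewrite /bform trZ -scalemxAr -!scalemxAl mxE mxE mulrA expr2.
Qed.

Lemma cvg_bform (R : realType) n (T : Type) (F : set_system T) {FF : Filter F}
    (S : 'M[R]_n) (h k : T -> 'cV[R]_n) (a b : 'cV[R]_n) :
  h @ F --> a -> k @ F --> b -> bform S (h x) (k x) @[x --> F] --> bform S a b.
Proof.
move=> ha kb; apply: cvg_mx_entry; apply: cvg_mulmx kb.
by apply: cvg_mulmx; [exact: cvg_trmx|exact: cvg_cst].
Qed.

(** The gap is continuous and positive on the compact product of [V] and the unit sphere, so it has
    a positive minimum there; homogeneity extends the bound to all vectors. *)
Lemma bform_lt_uniform (R : realType) n (A : 'cV[R]_n -> 'M[R]_n) (S S' : 'M[R]_n)
    (V : set 'cV[R]_n) : continuous A -> compact V ->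
  (forall z v, V z -> v != 0 -> bform S v v < bform S' (A z *m v) (A z *m v)) ->
  exists2 e, 0 < e & forall z v, V z ->
    bform S v v + e * `|v| ^+ 2 <= bform S' (A z *m v) (A z *m v).
Proof.
move=> cA cV lt.
pose P := V `*` [set v : 'cV[R]_n | `|v| = 1].
pose h p := bform S' (A p.1 *m p.2) (A p.1 *m p.2) - bform S p.2 p.2.
have h0 p : P p -> 0 < h p.
  move=> [/= Vz v1]; rewrite subr_gt0 lt// -normr_eq0.
  by rewrite v1 oner_eq0.
have cP : compact P by apply: compact_setX => //; exact: compact_unit_sphere.
have ch : continuous h.
  move=> p.
  have c1 : A q.1 @[q --> p] --> A p.1.
    by apply: (cvg_comp (@fst _ _) A _ (cA _)); exact: cvg_fst.
  have c2 : q.2 @[q --> p] --> p.2 by exact: cvg_snd.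
  have c3 : A q.1 *m q.2 @[q --> p] --> A p.1 *m p.2 by exact: cvg_mulmx.
  by apply: cvgB; exact: cvg_bform.
have [e e0 he] : exists2 e, 0 < e & forall p, P p -> e <= h p.
  have [P0|P0] := pselect (P !=set0); last first.
    (* The product is empty when [V] is empty or [n = 0]; any positive constant then works. *)
    by exists 1 => // p Pp; case: P0; exists p.
  have [c cIP cmin] := compact_EVT_min P0 cP (continuous_subspaceT ch).
  exists (h c) => [|p Pp]; first by apply: h0; move: cIP; rewrite inE.
  by apply: cmin; rewrite inE.
exists e => // z v Vz; have [->|v0] := eqVneq v 0.
  by rewrite mulmx0 -[X in bform S X X](scale0r 0) -[X in bform S' X X](scale0r 0)
     !bformZ normr0 expr0n/= !mul0r mulr0 addr0.
have nv0 : `|v| != 0 by rewrite normr_eq0.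
have := he (z, `|v|^-1 *: v); rewrite /h /= -scalemxAr !bformZ -mulrBr.
rewrite exprVn ler_pdivlMl ?exprn_gt0 ?normr_gt0// mulrC lerBrDl; apply.
by split => //=; rewrite normrZ normfV normr_id mulVf.
Qed.

Lemma exists_uniform_gt0 (R : realType) (I : eqType) (s : seq I) (P : I -> R -> Prop) :
  (forall i, i \in s -> exists2 e, 0 < e & P i e) ->
  (forall i e e', 0 < e' <= e -> P i e -> P i e') ->
  exists2 e, 0 < e & forall i, i \in s -> P i e.
Proof.
move=> ex mono; elim: s ex => [|i s IH] ex; first by exists 1.
have [e e0 Pe] := ex i (mem_head _ _).
have [|e' e'0 Pe'] := IH; first by move=> j js; apply: ex; rewrite inE js orbT.
exists (Num.min e e') => [|j]; first by rewrite lt_min e0.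
rewrite inE => /orP[/eqP ->|js].
  by apply: mono Pe; rewrite lt_min e0 e'0 ge_min lexx.
by apply: mono (Pe' _ js); rewrite lt_min e0 e'0 ge_min lexx orbT.
Qed.

(** The accumulator only grows, so an empty result forces every intermediate value to be empty. *)
Lemma foldl_fset0 (T : choiceType) (I : eqType) (F : {fset T} -> I -> {fset T}) s U :
  (forall U i, U `<=` F U i)%fset -> foldl F U s = fset0 ->
  U = fset0 /\ forall i, i \in s -> F fset0 i = fset0.
Proof.
move=> UF; elim: s U => [|i s IH] U //= /IH[F0 Fs].
have U0 : U = fset0 by apply/eqP; rewrite -fsubset0 -F0.
split => // j; rewrite inE => /orP[/eqP ->|]; last exact: Fs.
by rewrite -{1}U0.
Qed.

Lemma foldl_fsubset (T : choiceType) (I : Type) (F : {fset T} -> I -> {fset T}) s U :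
  (forall U i, U `<=` F U i)%fset -> (U `<=` foldl F U s)%fset.
Proof.
move=> UF; elim: s U => [|i s IH] U //=.
exact: fsubset_trans (UF U i) (IH _).
Qed.

Section Algorithm.
Context {R : realType} {n : nat} (ar : rigorous_arithmetic R n).
Context (G : digraph (set 'cV[R]_n)) (C : set 'cV[R]_n -> 'M[R]_n) (Q : 'M[R]_n).

(** A failed check on the edge from [V] to [W] would have put [V] into the result. The check
    therefore succeeded, and the enclosures contain the exact matrices at [z]. *)
Lemma cone_verification_posdef (f : 'cV[R]_n -> 'cV[R]_n) V W z :
  C1 f -> Q^T = Q -> cone_verification ar G C Q f = fset0 ->
  V \in vertices G -> W \in out V G -> compact V -> C V \in unitmx -> V z ->
  let B := C W *m Dmx f z *m invmx (C V) in posdef (B^T *m Q *m B - Q).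
Proof.
move=> f1 sQ cv0 VG WV cV CVu Vz B.
have grow1 V' (U : {fset set 'cV[R]_n}) (W' : set 'cV[R]_n) :
  (U `<=` (if verify_posdef ar (enclose_form ar Q
      (enclose_conj ar (C W') (enclose_D ar f V') (C V')))
    then U else U `|` [fset V']))%fset.
  by case: ifP => _; [exact: fsubset_refl|exact: fsubsetUl].
have [|_ /(_ V VG)] := foldl_fset0 _ cv0.
  by move=> U V'; exact: (foldl_fsubset _ _ (grow1 V')).
move=> cv1; have [|_ /(_ W WV)] := foldl_fset0 _ cv1; first exact: grow1.
move=> /=; case: ifP => [ver _|_ /fsetP/(_ V)]; last by rewrite !inE eqxx.
(* A successful check speaks of symmetric matrices only. *)
have sB (B' : 'M[R]_n) : (B'^T *m Q *m B' - Q)^T = B'^T *m Q *m B' - Q.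
  rewrite linearB /= sQ; congr (_ - _).
  by rewrite trmx_mul trmx_mul trmxK sQ mulmxA.
apply: (verify_posdefP ver); last exact: sB.
apply: enclose_formP; apply: enclose_conjP => //.
exact: enclose_DP.
Qed.

End Algorithm.

Lemma mulmx_bounded (R : realType) n (A : 'cV[R]_n -> 'M[R]_n) (K : set 'cV[R]_n) :
  continuous A -> compact K ->
  exists2 M, 0 < M & forall x (v : 'cV[R]_n), K x -> `|A x *m v| <= M * `|v|.
Proof.
move=> cA cK.
have [B [_ hB]] := compact_bounded (continuous_compact (continuous_subspaceT cA) cK).
have B1 : B < `|B| + 1 by rewrite (le_lt_trans (ler_norm _))// ltrDl.
exists (n%:R * (`|B| + 1) + 1) => [|x v Kx].
  by rewrite ltr_wpDl// mulr_ge0// addr_ge0.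
rewrite (le_trans (norm_mulmx _ _))// ler_wpM2r// (@le_trans _ _ (n%:R * (`|B| + 1)))//.
  by rewrite ler_wpM2l// (hB _ B1)//; exists x.
by rewrite lerDl.
Qed.

(** * The form in chart coordinates *)

Section ChartForm.
Context {R : realType} {u s : nat}.
Implicit Types C : 'M[R]_(u + s).

Definition chart_form C := C^T *m Qmx R u s *m C.

Lemma tr_Qmx : (Qmx R u s)^T = Qmx R u s.
Proof. by rewrite /Qmx tr_block_mx !trmx0 linearN /= !trmx1. Qed.

Lemma tr_chart_form C : (chart_form C)^T = chart_form C.
Proof. by rewrite !trmx_mul trmxK tr_Qmx mulmxA. Qed.

Lemma enorm0 n : enorm (0 : 'cV[R]_n) = 0.
Proof. by rewrite /enorm big1 ?sqrtr0// => i _; rewrite mxE expr0n. Qed.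

(** Take the preimage under [C] of {0} x R^s; a left inverse of its parametrisation gives the
    dimension. *)
Lemma chart_form_neg C : C \in unitmx ->
  exists2 F : {vspace 'cV[R]_(u + s)}, (s <= \dim F)%N &
    forall v, v \in F -> bform (chart_form C) v v <= 0.
Proof.
move=> Cu; pose J : 'M[R]_(u + s, s) := col_mx 0 1%:M.
exists (linfun (mulmx (invmx C *m J) : 'cV_s -> 'cV_(u + s)) @: fullv)%VS.
  rewrite (@dim_mulmx_image _ _ _ _ (row_mx 0 1%:M *m C))//.
  by rewrite mulmxA mulmxK// mul_row_col mul0mx add0r mulmx1.
move=> _ /memv_imgP[y _ ->]; rewrite lfunE /= bform_conj !mulmxA mulmxV// mul1mx.
by rewrite mul_col_mx mul0mx mul1mx /bform QmxE enorm0 expr0n sub0r oppr_le0 sqr_ge0.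
Qed.

Lemma chart_form_pos C : C \in unitmx ->
  exists2 F : {vspace 'cV[R]_(u + s)}, (u <= \dim F)%N &
    forall v, v \in F -> 0 <= bform (chart_form C) v v.
Proof.
move=> Cu; pose J : 'M[R]_(u + s, u) := col_mx 1%:M 0.
exists (linfun (mulmx (invmx C *m J) : 'cV_u -> 'cV_(u + s)) @: fullv)%VS.
  rewrite (@dim_mulmx_image _ _ _ _ (row_mx 1%:M 0 *m C))//.
  by rewrite mulmxA mulmxK// mul_row_col mul0mx addr0 mulmx1.
move=> _ /memv_imgP[y _ ->]; rewrite lfunE /= bform_conj !mulmxA mulmxV// mul1mx.
by rewrite mul_col_mx mul0mx mul1mx /bform QmxE enorm0 expr0n subr0 sqr_ge0.
Qed.

End ChartForm.

(** * The cone system of a verified graph *)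

Section Verification.
Context {R : realType} {u s : nat}.
Local Notation E := 'cV[R]_(u + s).
Context (ar : rigorous_arithmetic R (u + s)).
Context (G : digraph (set E)) (C : set E -> 'M[R]_(u + s)).
Context (f : E -> E).
Context (f1 : C1 f) (G_compact : forall V, V \in vertices G -> compact V).
Context (repr : encodes_representation G f).
Context
  (C_unit : forall V, V \in vertices G -> C V \in unitmx)
  (verified : cone_verification ar G C (Qmx R u s) f = fset0).

Lemma out_vertex V W : W \in out V G -> W \in vertices G.
Proof. by rewrite !inE => /andP[]. Qed.

(** Evaluate the verified positive definite matrix at C_V v: the conjugated derivative sends it to
    C_W Df(z) v. *)
Lemma chart_form_lt V W z v : V \in vertices G -> W \in out V G -> V z -> v != 0 ->
  bform (chart_form (C V)) v v <
  bform (chart_form (C W)) (Dmx f z *m v) (Dmx f z *m v).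
Proof.
move=> VG WV Vz v0.
have Vu := C_unit VG.
have w0 : C V *m v != 0.
  apply: contra v0 => /eqP Cv; by rewrite -[v]mul1mx -(mulVmx Vu) -mulmxA Cv mulmx0.
have := cone_verification_posdef f1 tr_Qmx verified VG WV (G_compact VG) Vu Vz w0.
rewrite -/(bform _ _ _) bformB bform_conj -mulmxA mulKmx//.
by rewrite subr_gt0 !bform_conj mulmxA.
Qed.

(** Compactness gives a constant for each edge, and the edges are finite in number. *)
Lemma chart_form_growth : exists2 e, 0 < e & forall V W, V \in vertices G ->
  W \in out V G -> forall z v, V z ->
    bform (chart_form (C V)) v v + e * `|v| ^+ 2 <=
    bform (chart_form (C W)) (Dmx f z *m v) (Dmx f z *m v).
Proof.
have [] := @exists_uniform_gt0 R _ (enum_fset (edges G)) (fun p e => forall z v, p.1 z ->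
    bform (chart_form (C p.1)) v v + e * `|v| ^+ 2 <=
    bform (chart_form (C p.2)) (Dmx f z *m v) (Dmx f z *m v)).
- move=> [V W] VW; have [VG WG] := edgesP VW.
  apply: bform_lt_uniform; [exact: f1.2|exact: G_compact|].
  by move=> z v; apply: chart_form_lt => //; rewrite !inE WG.
- move=> p e e' /andP[_ ee'] h z v Vz; apply: le_trans (h z v Vz).
  by rewrite lerD2l ler_wpM2r// sqr_ge0.
move=> e e0 h; exists e => // V W VG; rewrite !inE => /andP[WG VW].
exact: (h (V, W)).
Qed.

(** Writing the bound as an inverse lets [exists_uniform_gt0], which looks for a small constant,
    provide a large one. *)
Lemma chart_form_bounded : exists2 B, 0 < B & forall V v w, V \in vertices G ->
  `|bform (chart_form (C V)) v w| <= B * (`|v| * `|w|).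
Proof.
have [] := @exists_uniform_gt0 R _ (enum_fset (vertices G)) (fun V e => forall v w,
  `|bform (chart_form (C V)) v w| <= e^-1 * (`|v| * `|w|)).
- move=> V VG; pose B := (u + s)%:R ^+ 2 * `|chart_form (C V)| + 1.
  have B0 : 0 < B by rewrite ltr_wpDl// mulr_ge0// sqr_ge0.
  exists B^-1 => [|v w]; first by rewrite invr_gt0.
  rewrite invrK (le_trans (norm_form_le _ _ _))// ler_wpM2r ?mulr_ge0//.
  by rewrite lerDl.
- move=> V e e' /andP[e'0 ee'] h v w; apply: le_trans (h v w) _.
  by rewrite ler_wpM2r ?mulr_ge0// lef_pV2// posrE (lt_le_trans e'0).
by move=> e e0 h; exists e^-1 => [|V v w VG]; [rewrite invr_gt0|exact: h].
Qed.

(** A vertex containing a point has an out-neighbour containing its image; choose such neighbours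
    recursively. *)
Lemma orbit_path x : supp (vertices G) x -> exists V : nat -> set E,
  forall j, [/\ V j \in vertices G, V j (iter j f x) & V j.+1 \in out (V j) G].
Proof.
move=> [V0 /= V0G V0x].
have next (p : set E * E) : exists W, p.1 \in vertices G -> p.1 p.2 ->
    W \in out p.1 G /\ W (f p.2).
  have [[pG p2]|np] := pselect (p.1 \in vertices G /\ p.1 p.2); last first.
    (* [set0] is a dummy value for pairs that are not a vertex with one of its points. *)
    by exists set0 => pG p2; case: np.
  have [|W /= WV Wf] := @repr p.2 _ p.1 pG p2; first by exists p.1.
  by exists W.
have [F FP] := choice next.
pose V := fix V j := if j is i.+1 then F (V i, iter i f x) else V0.
have VP j : V j \in vertices G /\ V j (iter j f x).
  elim: j => [|j [VG Vx]] //=.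
  by have [/out_vertex] := FP (V j, iter j f x) VG Vx.
exists V => j; have [VG Vx] := VP j; split => //.
by have [] := FP (V j, iter j f x) VG Vx.
Qed.

Definition Dcocycle : cocycle R (u + s) E :=
  @Cocycle R (u + s) E f (fun k => Dmx (iter k f)) (Dmx_iter0 f)
    (fun k m x => Dmx_iterD k m x f1.1).

Lemma verified_cone_system K : K `<=` supp (vertices G) ->
  cone_system Dcocycle K s u.
Proof.
move=> KG; have [e e0 he] := chart_form_growth.
have [B B0 hB] := chart_form_bounded.
exists e, B; split => // x N Kx; have [V VP] := orbit_path (KG _ Kx).
exists (fun j => chart_form (C (V j))); split => [j|j v jN].
  have [VG _ _] := VP j; split; first exact: tr_chart_form.
  - by move=> v w; exact: hB.
  - exact/chart_form_neg/C_unit.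
  - exact/chart_form_pos/C_unit.
have [VG Vx WV] := VP j; exact: (he _ _ VG WV).
Qed.

End Verification.

(** * Hyperbolicity *)

Lemma inverse_Dcocycle (R : realType) (u s : nat) (f g : 'cV[R]_(u + s) -> 'cV[R]_(u + s))
    (f1 : C1 f) (g1 : C1 g) : cancel f g -> inverse_cocycle (Dcocycle g1) (Dcocycle f1).
Proof. by move=> fK; split => // x; exact: Dmx_cancel fK f1.1 g1.1. Qed.

Section Hyperbolicity.
Context {R : realType} {n : nat}.
Implicit Types (f g : cocycle R n 'cV[R]_n) (K : set 'cV[R]_n).

Lemma cone_system_hyperbolic f g K s u M :
  inverse_cocycle g f -> inverse_cocycle f g ->
  (forall k, continuous (f k)) -> (forall k, continuous (g k)) ->
  (forall k x v, 'd (iter k (base f)) x v = f k x *m v) ->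
  (forall k x v, 'd (iter k (base g)) x v = g k x *m v) ->
  compact K -> (forall x, K x -> K (base f x)) -> (forall x, K x -> K (base g x)) ->
  0 < M -> (forall x (v : 'cV[R]_n), K x -> `|f 1 x *m v| <= M * `|v|) ->
  (s + u = n)%N -> cone_system f K s u ->
  uniformly_hyperbolic (base f) (base g) K.
Proof.
move=> gf fg fC gC df dg cK Kf Kg M0 fM sun csf.
have csg := cone_system_inv gf fg Kg M0 fM csf.
have cf := cone_system_contracting csf; have cg := cone_system_contracting csg.
have tr := cone_system_transverse gf fg Kg M0 fM csf cf cg.
have cap0 x : K x -> (stable f x :&: stable g x)%VS = 0%VS.
  move=> Kx; have [c _ hc] := tr; apply/eqP; rewrite -subv0; apply/subvP => v.
  rewrite memv_cap memv0 => /andP[vf vg].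
  have : - v \in stable g x by rewrite memvN.
  move=> /(hc x v _ Kx vf); rewrite subrr normr0 mulr0 normrN => h.
  by rewrite -normr_eq0; have := normr_ge0 v; lra.
(* The lower bounds [s] and [u] already add up to [n], and the spaces are independent, so both are
   attained. *)
have dims x : K x -> \dim (stable f x) = s /\ \dim (stable g x) = u.
  move=> Kx; have := dimv_disjoint_sum (cap0 x Kx).
  have := cone_system_dim gf csf Kx; have := cone_system_dim fg csg Kx.
  have := dimvS (subvf (stable f x + stable g x)).
  by rewrite dimvf /dim /= muln1; lia.
have full x : K x -> (stable f x + stable g x)%VS = fullv.
  move=> Kx; apply/eqP; rewrite eqEdim subvf dimvf /dim /= muln1.
  by rewrite dimv_disjoint_sum ?cap0//; have [-> ->] := dims x Kx; rewrite sun.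
split => //.
  apply/seteqP; split => x /=; first by case=> y Ky <-; exact: Kf.
  by move=> Kx; exists (base g x); [exact: Kg|exact: fg.1].
exists (stable g), (stable f); split.
- split.
    apply: (stable_subbundle fg gf gC fC Kg Kf cg cf (transverseC tr) (d := u)).
    + by move=> y Ky; rewrite addvC full.
    + by move=> y Ky; rewrite capvC cap0.
    + by move=> y /dims[].
  apply: (stable_subbundle gf fg fC gC Kf Kg cf cg tr (d := s)) => //.
  by move=> y /dims[].
- by move=> x Kx; rewrite addvC capvC full// cap0.
- have df1 x v : linfun ('d (base f) x) v = f 1 x *m v by rewrite lfunE; exact: df 1 x v.
  split => x Kx; apply/vspaceP => w; apply/idP/idP.
  + move=> /memv_imgP[v vS ->]; rewrite df1.
    exact: (stable_inv_fwd 1 gf).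
  + move=> wS; apply/memv_imgP; exists (g 1 (base f x) *m w).
      by have := stable_fwd wS; rewrite gf.1.
    by rewrite df1 mulmxA mulmx1C ?mul1mx// gf.2.
  + by move=> /memv_imgP[v vS ->]; rewrite df1 stable_fwd.
  + move=> wS; apply/memv_imgP.
    have fgw : f 1 x *m (g 1 (base f x) *m w) = w.
      by rewrite mulmxA mulmx1C ?mul1mx// gf.2.
    exists (g 1 (base f x) *m w); last by rewrite df1.
    by apply: stable_bwd; rewrite fgw.
have [c1 [l1 [c10 /andP[l10 l11] h1]]] := cf.
have [c2 [l2 [c20 /andP[l20 l21] h2]]] := cg.
have n0 : 0 < n%:R + 1 :> R by rewrite ltr_wpDl.
(* Passing from the sup norm to the Euclidean norm costs a factor [n]; [n + 1] stays positive when
   [n = 0]. *)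
have enormM (A : 'M[R]_n) (v : 'cV[R]_n) c l k : 0 < c -> 0 < l ->
    c <= c1 + c2 -> l <= Num.max l1 l2 -> `|A *m v| <= c * l ^+ k * `|v| ->
    enorm (A *m v) <= (n%:R + 1) * (c1 + c2) * Num.max l1 l2 ^+ k * enorm v.
  move=> c0 l0 cc ll h.
  apply: (le_trans (enorm_le_norm _)).
  apply: (@le_trans _ _ ((n%:R + 1) * (c * l ^+ k * `|v|))).
    by apply: ler_pM => //; rewrite lerDl.
  rewrite -!mulrA ler_pM2l//; apply: ler_pM => //; first exact: ltW.
    by rewrite mulr_ge0// exprn_ge0// ltW.
  apply: ler_pM => //; first by rewrite exprn_ge0// ltW.
    by rewrite lerXn2r// nnegrE ltW// (lt_le_trans l0).
  exact: norm_le_enorm.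
exists ((n%:R + 1) * (c1 + c2)), (Num.max l1 l2); split.
- by rewrite mulr_gt0// addr_gt0.
- by rewrite lt_max l10 gt_max l11 l21.
- move=> x k v Kx vS; rewrite df; apply: (enormM _ _ _ _ _ c10 l10); last exact: h1.
    by rewrite lerDl ltW.
  by rewrite le_max lexx.
- move=> x k v Kx vS; rewrite dg; apply: (enormM _ _ _ _ _ c20 l20); last exact: h2.
    by rewrite lerDr ltW.
  by rewrite le_max lexx orbT.
Qed.

End Hyperbolicity.

(** * The maximal invariant set and the conclusion *)

Lemma invariant_part_compact (R : realType) n (f g : 'cV[R]_n -> 'cV[R]_n) M :
  continuous f -> continuous g -> compact M -> compact (invariant_part f g M).
Proof.
move=> cf cg cM; have clM := compact_closed (@norm_hausdorff _ _) cM.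
apply: subclosed_compact cM _; last by move=> x [].
have -> : invariant_part f g M =
    \bigcap_(k in [set: nat]) (iter k f @^-1` M `&` iter k g @^-1` M).
  apply/seteqP; split => [x [_ h] k _|x h]; first exact: h.
  by split => [|k]; [have [] := h 0%N I|exact: h].
apply: closed_bigI => k _; apply: closedI.
  by apply: preimage_closed clM => x _; exact: continuous_iter.
by apply: preimage_closed clM => x _; exact: continuous_iter.
Qed.

Lemma invariant_part_fwd (T : Type) (f g : T -> T) M x : cancel f g ->
  invariant_part f g M x -> invariant_part f g M (f x).
Proof.
move=> fK [Mx h]; split => [|k]; first by have [] := h 1%N.
split; first by rewrite -iterSr; have [] := h k.+1.
case: k => [|k]; first by have [] := h 1%N.
by rewrite iterSr fK; have [] := h k.
Qed.

Lemma invariant_partC (T : Type) (f g : T -> T) M :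
  invariant_part f g M = invariant_part g f M.
Proof.
by apply/seteqP; split => x [Mx h]; split => // k; have [] := h k.
Qed.

Lemma supp_compact (R : realType) n (A : {fset set 'cV[R]_n}) :
  (forall V, V \in A -> compact V) -> compact (supp A).
Proof.
move=> cA.
have -> : supp A = \big[setU/set0]_(V <- enum_fset A | V \in A) V.
  rewrite -bigcup_seq_cond; apply/seteqP; split => x [V /= VA Vx]; exists V => //=.
    by rewrite VA.
  by case/andP: VA.
exact: bigsetU_compact.
Qed.

Theorem corollary13 (R : realType) (u s : nat)
    (f finv : 'cV[R]_(u + s) -> 'cV[R]_(u + s))
    (G : digraph (set 'cV[R]_(u + s)))
    (C : set 'cV[R]_(u + s) -> 'M[R]_(u + s))
    (ar : rigorous_arithmetic R (u + s)) :
  C1_diffeo f finv ->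
  (forall V, V \in vertices G -> compact V) ->
  (forall V W, V \in vertices G -> W \in vertices G -> V <> W ->
     interior V `&` interior W = set0) ->
  encodes_representation G f ->
  (forall V, V \in vertices G -> C V \in unitmx) ->
  cone_verification ar G C (Qmx R u s) f = fset0 ->
  uniformly_hyperbolic f finv (invariant_part f finv (supp (vertices G))).
Proof.
move=> [fK finvK f1 finv1] cG _ repr Cu verified.
set K := invariant_part _ _ _.
have cK : compact K.
  by apply: invariant_part_compact; [exact: C1_continuous..|exact: supp_compact].
(* This bound on Df over [K] carries the cone condition to the inverse map. *)
have [M M0 hM] := mulmx_bounded f1.2 cK.
apply: (@cone_system_hyperbolic _ _ (Dcocycle f1) (Dcocycle finv1) K s u M).
- exact: inverse_Dcocycle.
- exact: inverse_Dcocycle.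
- by move=> k; exact: continuous_Dmx_iter.
- by move=> k; exact: continuous_Dmx_iter.
- by move=> k x v; apply: diff_Dmx; exact: differentiable_iter f1.1.
- by move=> k x v; apply: diff_Dmx; exact: differentiable_iter finv1.1.
- exact: cK.
- by move=> x; exact: invariant_part_fwd.
- by move=> x; rewrite /K invariant_partC; exact: invariant_part_fwd.
- exact: M0.
- exact: hM.
- exact: addnC.
- by apply: verified_cone_system verified _ _ => // x [].
Qed.
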